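(* Let $\mathcal A$ be a unital complex $*$-algebra and let $(\Omega^1_{\mathrm d}(\mathcal A),\dagger,\Psi,\langle\cdot|\cdot\rangle,\sigma^{\mathrm{can}})$ be a centred Hermitian differential calculus over $\mathcal A$. Then the triple $(\overleftarrow{\mathcal X}(\mathcal A),\langle\cdot|\cdot\rangle_{\mathcal A},D_\varphi)$, where $D_\varphi=(D,\varphi)$, is a right real metric calculus. Symmetrically, the triple $(\overrightarrow{\mathcal X}(\mathcal A),{}_{\mathcal A}\langle\cdot|\cdot\rangle,D_\varphi)$ is a left real metric calculus. In both cases the inner products are strongly non-degenerate.
   Context: Throughout $\mathcal A$ is a unital complex $*$-algebra. A $\dagger$-bimodule is an $\mathcal A$-bimodule with an antilinear involution $\dagger$ satisfying $(axb)^\dagger=b^*x^\dagger a^*$. **First-order structure.** A Hermitian first-order differential structure over $\mathcal A$ consists of a $\dagger$-bimodule $\Omega=\Omega^1_{\mathrm d}(\mathcal A)$, a $\mathbb C$-linear derivation $\mathrm d:\mathcal A\to\Omega$ with $\mathrm d(a^* )=-\mathrm d(a)^\dagger$, such that every element of $\Omega$ is a finite sum $\sum a_i\,\mathrm d b_i$, $\Omega$ is finitely generated projective as an $\mathcal A$-module, together with a biadditive map $\langle\cdot|\cdot\rangle_{\mathcal A}:\Omega\times\Omega\to\mathcal A$ with: (1) $\langle\omega|\eta a\rangle=\langle\omega|\eta\rangle a$; (2) $\langle\omega|\eta\rangle^*=\langle\eta|\omega\rangle$; (3) $\langle a\omega|\eta\rangle=\langle\omega|a^*\eta\rangle$; (4)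 $\omega\mapsto(\eta\mapsto\langle\omega^\dagger|\eta\rangle)$ is an isomorphism of left $\mathcal A$-modules from $\Omega$ onto the right-$\mathcal A$-linear maps $\Omega\to\mathcal A$. The left inner product is ${}_{\mathcal A}\langle\omega|\rho\rangle=\langle\omega^\dagger|\rho^\dagger\rangle_{\mathcal A}$. **Centred calculus.** $T^2_{\mathrm d}(\mathcal A)=\Omega\otimes_{\mathcal A}\Omega$ with $(\omega\otimes\eta)^\dagger=\eta^\dagger\otimes\omega^\dagger$. The centre of a bimodule is $\mathcal Z(\mathcal Y)=\{y:ay=ya\ \forall a\}$; $\mathcal Y$ is centred if generated as a bimodule by $\mathcal Z(\mathcal Y)$. If $\Omega$ is centred there is a unique invertible bimodule map $\sigma^{\mathrm{can}}$ on $T^2_{\mathrm d}(\mathcal A)$ with $(\sigma^{\mathrm{can}})^{-1}\circ\dagger=\dagger\circ\sigma^{\mathrm{can}}$ and $\sigma^{\mathrm{can}}(\omega\otimes\eta)=\eta\otimes\omega$ whenever $\omega$ or $\eta$ is central; it is an involution. Put $\Psi=\frac12(1+\sigma^{\mathrm{can}})$, $g(\omega\otimes\eta)=-\langle\omega^\dagger|\eta\rangle_{\mathcal A}$, $JT^2_{\mathrm d}=\{\sum\mathrm d a_i\otimes\mathrm d b_i:\sum a_i\,\mathrm d b_i=0\}$. A centred Hermitian differential calculus is a Hermitian first-order differential structure such that $\Omega$ is centred, $g\circ\sigma^{\mathrm{can}}=g$ and $JT^2_{\mathrm d}\subset\operatorname{Im}\Psi$. **Vector fields.** $\overrightarrow{\mathcal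 X}(\mathcal A)$, $\overleftarrow{\mathcal X}(\mathcal A)$, $\overleftrightarrow{\mathcal X}(\mathcal A)$ are the right-linear, left-linear and bimodule maps $\Omega\to\mathcal A$. $\overrightarrow{\mathcal X}(\mathcal A)$ is a left module via $(aX)(\omega)=aX(\omega)$ and $\overleftarrow{\mathcal X}(\mathcal A)$ a right module via $(Yb)(\omega)=Y(\omega)b$. The musical isomorphisms are $\overrightarrow\sharp:\Omega\to\overrightarrow{\mathcal X}(\mathcal A)$, $\omega\mapsto(\eta\mapsto\langle\omega^\dagger|\eta\rangle_{\mathcal A})$ and $\overleftarrow\sharp:\Omega\to\overleftarrow{\mathcal X}(\mathcal A)$, $\omega\mapsto(\eta\mapsto\langle\eta^\dagger|\omega\rangle_{\mathcal A})$, with inverses $\overrightarrow\flat,\overleftarrow\flat$. Inner products: $\langle X|Y\rangle_{\mathcal A}=\langle X^{\overleftarrow\flat}|Y^{\overleftarrow\flat}\rangle_{\mathcal A}$ on $\overleftarrow{\mathcal X}(\mathcal A)$ and ${}_{\mathcal A}\langle U|V\rangle={}_{\mathcal A}\langle U^{\overrightarrow\flat}|V^{\overrightarrow\flat}\rangle$ on $\overrightarrow{\mathcal X}(\mathcal A)$. Strong non-degeneracy of these means that $X\mapsto\langle X|\cdot\rangle_{\mathcal A}$ is a bijection of $\overleftarrow{\mathcal X}(\mathcal A)$ onto its right-linear dual, respectively $V\mapsto{}_{\mathcal A}\langle\cdot|V\rangle$ is a bijection of $\overrightarrow{\mathcal X}(\mathcal A)$ onto its left-linear dual. **Derivations.**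 $\mathrm{Der}(\mathcal A)$ is the set of $\mathbb C$-linear derivations of $\mathcal A$; $\partial$ is Hermitian if $\partial(a^* )^*=\partial(a)$ for all $a$. $D_{\mathbb C}=\{\partial\in\mathrm{Der}(\mathcal A):\sum a_i\,\mathrm d b_i=0\Rightarrow\sum a_i\partial b_i=0\}$, $D$ is the set of Hermitian elements of $D_{\mathbb C}$, and $\varphi:D_{\mathbb C}\to\overleftrightarrow{\mathcal X}(\mathcal A)$, $\varphi(\partial)(\sum a_i\,\mathrm d b_i)=\sum a_i\partial b_i$. **Metric calculi.** A right real metric calculus is a triple $(\mathcal X,\langle\cdot|\cdot\rangle,\mathfrak g_\varphi)$ where $\mathcal X$ is a right $\mathcal A$-module; $\langle\cdot|\cdot\rangle:\mathcal X\times\mathcal X\to\mathcal A$ satisfies $\langle X|Y+Z\rangle=\langle X|Y\rangle+\langle X|Z\rangle$, $\langle X|Ya\rangle=\langle X|Y\rangle a$, $\langle X|Y\rangle^*=\langle Y|X\rangle$, and $\langle X|Y\rangle=0$ for all $Y$ implies $X=0$; $\mathfrak g$ is the real Lie algebra of Hermitian derivations in a complex Lie subalgebra $\mathfrak g_{\mathbb C}\subset\mathrm{Der}(\mathcal A)$, $\varphi:\mathfrak g_{\mathbb C}\to\mathcal X$ is $\mathbb C$-linear and $\mathfrak g_\varphi=(\mathfrak g,\varphi)$; $\varphi(\mathfrak g)$ generates $\mathcal X$ as a right $\mathcal A$-module; and $\langle X|Y\rangle^*=\langle X|Y\rangle$ for all $X,Y\in\varphi(\mathfrak g)$. A left real metric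 calculus is defined analogously for a left module, with ${}_{\mathcal A}\langle aX|Y\rangle=a\,{}_{\mathcal A}\langle X|Y\rangle$ replacing right linearity. Here $\mathfrak g_{\mathbb C}=D_{\mathbb C}$ and $\mathfrak g=D$. *)

(* Defs.v *)
From HB Require Import structures.
From mathcomp Require Import all_boot all_order all_algebra.
From mathcomp Require Import boolp classical_sets functions.
From mathcomp Require Import reals complex.

Set Implicit Arguments.
Unset Strict Implicit.
Unset Printing Implicit Defensive.

Import Order.TTheory GRing.Theory Num.Theory.
Local Open Scope classical_set_scope.
Local Open Scope quotient_scope.
Local Open Scope ring_scope.

HB.mixin Record isStarAlgebra (C : numClosedFieldType) A
    of GRing.Algebra C A := {
  star : A -> A;
  starD : forall a b : A, star (a + b) = star a + star b;
  starZ : forall (c : C) (a : A), star (c *: a) = c^* *: star a;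
  starM : forall a b : A, star (a * b) = star b * star a;
  starK : involutive star
}.

#[short(type="starAlgType")]
HB.structure Definition StarAlgebra (C : numClosedFieldType) :=
  { A of isStarAlgebra C A & GRing.Algebra C A }.

(* Right modules could be lmodTypes over the converse ring A^c, but a bimodule
   needs a left and a right action on one and the same carrier. *)
HB.mixin Record isRightModule (A : pzRingType) M of GRing.Zmodule M := {
  rscale : M -> A -> M;
  rscaleA : forall (x : M) (a b : A), rscale (rscale x a) b = rscale x (a * b);
  rscale1 : forall x : M, rscale x 1 = x;
  rscaleDl : forall (x y : M) (a : A),
    rscale (x + y) a = rscale x a + rscale y a;
  rscaleDr : forall (x : M) (a b : A),
    rscale x (a + b) = rscale x a + rscale x b
}.

#[short(type="rmodType")]
HB.structure Definition RightModule (A : pzRingType) :=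
  { M of isRightModule A M & GRing.Zmodule M }.

Notation "x :* a" := (rscale x a) (at level 40) : ring_scope.

(* Complex scalars act on an A-(bi)module through c%:A = c *: 1. *)
HB.mixin Record isBimodule (C : numClosedFieldType) (A : starAlgType C) M
    of GRing.Lmodule A M & isRightModule A M := {
  scale_rscale : forall (a b : A) (x : M), a *: (x :* b) = (a *: x) :* b;
  scalar_bimod : forall (c : C) (x : M), (c%:A : A) *: x = x :* (c%:A : A)
}.

#[short(type="bimodType")]
HB.structure Definition Bimodule (C : numClosedFieldType) (A : starAlgType C) :=
  { M of isBimodule C A M & GRing.Lmodule A M & isRightModule A M }.

HB.mixin Record isDagger (C : numClosedFieldType) (A : starAlgType C) M
    of Bimodule C A M := {
  dag : M -> M;
  dagD : forall x y : M, dag (x + y) = dag x + dag y;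
  dagZ : forall (c : C) (x : M),
    dag ((c%:A : A) *: x) = ((c^*)%:A : A) *: dag x;
  dagK : involutive dag;
  dagM : forall (a b : A) (x : M),
    dag ((a *: x) :* b) = (star b *: dag x) :* star a
}.

#[short(type="dagBimodType")]
HB.structure Definition DaggerBimodule (C : numClosedFieldType)
    (A : starAlgType C) :=
  { M of isDagger C A M & Bimodule C A M }.

Section BasicFacts.
Context {A : pzRingType} {M : rmodType A}.
Implicit Types (x y : M) (a : A).

Lemma rscale0l a : (0 : M) :* a = 0.
Proof. by apply: (addIr (0 :* a)); rewrite -rscaleDl !add0r. Qed.

Lemma rscale0r x : x :* (0 : A) = 0.
Proof. by apply: (addIr (x :* 0)); rewrite -rscaleDr !add0r. Qed.

Lemma rscaleNl x a : (- x) :* a = - (x :* a).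
Proof. by apply: (addIr (x :* a)); rewrite -rscaleDl !addNr rscale0l. Qed.

Lemma rscale_suml (I : Type) (r : seq I) (F : I -> M) a :
  (\sum_(i <- r) F i) :* a = \sum_(i <- r) F i :* a.
Proof.
by elim: r => [|i r IH]; rewrite ?big_nil ?rscale0l // !big_cons rscaleDl IH.
Qed.

End BasicFacts.

Section DaggerFacts.
Context {C : numClosedFieldType} {A : starAlgType C}.

Lemma star0 : star (0 : A) = 0.
Proof. by apply: (addIr (star (0 : A))); rewrite -starD !add0r. Qed.

Lemma star1 : star (1 : A) = 1.
Proof. by rewrite -[LHS]mulr1 -{2}(starK (1 : A)) -starM mulr1 starK. Qed.

Lemma dag_scale (M : dagBimodType A) (a : A) (x : M) :
  dag (a *: x) = dag x :* star a.
Proof. by rewrite -[X in dag X]rscale1 dagM star1 scale1r. Qed.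

Lemma dag_rscale (M : dagBimodType A) (a : A) (x : M) :
  dag (x :* a) = star a *: dag x.
Proof. by rewrite -[X in dag (X :* _)](scale1r x) dagM star1 rscale1. Qed.

End DaggerFacts.

(* M (x)_A N: finite formal sums of pairs, identified by the least congruence
   for concatenation that makes pairs biadditive and A-balanced. *)
Section Tensor.
Context {C : numClosedFieldType} {A : starAlgType C} (M N : bimodType A).

Inductive tens_rel : seq (M * N) -> seq (M * N) -> Prop :=
| tens_refl s : tens_rel s s
| tens_sym s t : tens_rel s t -> tens_rel t s
| tens_trans s t u : tens_rel s t -> tens_rel t u -> tens_rel s u
| tens_cat s s' t t' :
    tens_rel s s' -> tens_rel t t' -> tens_rel (s ++ t) (s' ++ t')
| tens_catC s t : tens_rel (s ++ t) (t ++ s)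
| tens_zero y : tens_rel [:: (0, y)] [::]
| tens_addl x x' y : tens_rel [:: (x + x', y)] [:: (x, y); (x', y)]
| tens_addr x y y' : tens_rel [:: (x, y + y')] [:: (x, y); (x, y')]
| tens_bal x (a : A) y : tens_rel [:: (x :* a, y)] [:: (x, a *: y)].

Definition tens_relb (s t : seq (M * N)) : bool := `[< tens_rel s t >].

Lemma tens_relb_refl : reflexive tens_relb.
Proof. by move=> s; apply/asboolP; exact: tens_refl. Qed.

Lemma tens_relb_sym : symmetric tens_relb.
Proof. by move=> s t; apply/asboolP/asboolP; exact: tens_sym. Qed.

Lemma tens_relb_trans : transitive tens_relb.
Proof.
by move=> t s u /asboolP st /asboolP tu; apply/asboolP; exact: tens_trans tu.
Qed.

Canonical tens_equiv :=
  EquivRel tens_relb tens_relb_refl tens_relb_sym tens_relb_trans.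

Definition tensor : Type := {eq_quot tens_equiv}.
HB.instance Definition _ := Choice.on tensor.
HB.instance Definition _ := EqQuotient.on tensor.

Definition tens_class (s : seq (M * N)) : tensor := \pi_tensor s.

Lemma tens_classW (P : tensor -> Prop) : (forall s, P (tens_class s)) -> forall t, P t.
Proof. by move=> PP; elim/quotW. Qed.

Lemma tens_eqP (s t : seq (M * N)) :
  tens_class s = tens_class t <-> tens_rel s t.
Proof. by rewrite /tens_class; split=> [/eqmodP/asboolP|st]; last by apply/eqmodP/asboolP. Qed.

Lemma tens_repr (s : seq (M * N)) : tens_rel (repr (tens_class s)) s.
Proof. by apply/tens_eqP; rewrite /tens_class reprK. Qed.

Definition tens (x : M) (y : N) : tensor := tens_class [:: (x, y)].

Definition tens_opps (s : seq (M * N)) := [seq (- p.1, p.2) | p <- s].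

Lemma tens_opps_rel s t : tens_rel s t -> tens_rel (tens_opps s) (tens_opps t).
Proof.
elim=> {s t}.
- by move=> s; exact: tens_refl.
- by move=> s t _; exact: tens_sym.
- by move=> s t u _ st _; exact: tens_trans.
- by move=> s s' t t' _ ss' _ tt'; rewrite /tens_opps !map_cat; exact: tens_cat.
- by move=> s t; rewrite /tens_opps !map_cat; exact: tens_catC.
- by move=> y; rewrite /= oppr0; exact: tens_zero.
- by move=> x x' y; rewrite /= opprD; exact: tens_addl.
- by move=> x y y'; exact: tens_addr.
- by move=> x a y; rewrite /= -rscaleNl; exact: tens_bal.
Qed.

Definition tens_zero_elt : tensor := tens_class [::].
Definition tens_add (t u : tensor) : tensor := tens_class (repr t ++ repr u).
Definition tens_opp (t : tensor) : tensor := tens_class (tens_opps (repr t)).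

Lemma tens_addE (s t : seq (M * N)) :
  tens_add (tens_class s) (tens_class t) = tens_class (s ++ t).
Proof. by apply/tens_eqP/tens_cat; exact: tens_repr. Qed.

Lemma tens_addA : associative tens_add.
Proof.
by elim/tens_classW=> s; elim/tens_classW=> t; elim/tens_classW=> u; rewrite !tens_addE catA.
Qed.

Lemma tens_addC : commutative tens_add.
Proof.
by elim/tens_classW=> s; elim/tens_classW=> t; rewrite !tens_addE; apply/tens_eqP/tens_catC.
Qed.

Lemma tens_add0 : left_id tens_zero_elt tens_add.
Proof. by elim/tens_classW=> s; rewrite /tens_zero_elt tens_addE. Qed.

Lemma tens_opps_cat s : tens_rel (tens_opps s ++ s) [::].
Proof.
elim: s => [|[x y] s IH] /=; first exact: tens_refl.
apply: (@tens_trans _ ((tens_opps s ++ s) ++ [:: (- x, y); (x, y)])).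
  rewrite -catA.
  apply: (@tens_trans _ ((tens_opps s ++ ([:: (x, y)] ++ s)) ++ [:: (- x, y)])).
    exact: (tens_catC [:: (- x, y)]).
  rewrite -catA; apply: tens_cat; first exact: tens_refl.
  apply: (@tens_trans _ ((s ++ [:: (x, y)]) ++ [:: (- x, y)])).
    by apply: tens_cat; [exact: tens_catC|exact: tens_refl].
  rewrite -catA; apply: tens_cat; first exact: tens_refl.
  exact: (tens_catC [:: (x, y)] [:: (- x, y)]).
apply: (tens_cat IH (t' := [::])).
apply: tens_trans (tens_sym (tens_addl _ _ _)) _.
by rewrite addNr; exact: tens_zero.
Qed.

Lemma tens_addN : left_inverse tens_zero_elt tens_opp tens_add.
Proof.
elim/tens_classW=> s; rewrite /tens_opp tens_addE; apply/tens_eqP.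
apply: tens_trans (tens_opps_cat s); apply: tens_cat; last exact: tens_refl.
exact/tens_opps_rel/tens_repr.
Qed.

HB.instance Definition _ := GRing.isZmodule.Build tensor
  tens_addA tens_addC tens_add0 tens_addN.

Lemma tensDl x x' y : tens (x + x') y = tens x y + tens x' y.
Proof. by rewrite [RHS]tens_addE; apply/tens_eqP/tens_addl. Qed.

Lemma tensDr x y y' : tens x (y + y') = tens x y + tens x y'.
Proof. by rewrite [RHS]tens_addE; apply/tens_eqP/tens_addr. Qed.

Lemma tensA x (a : A) y : tens (x :* a) y = tens x (a *: y).
Proof. exact/tens_eqP/tens_bal. Qed.

Lemma tens0l y : tens 0 y = 0.
Proof. exact/tens_eqP/tens_zero. Qed.

Lemma tens_piE (s : seq (M * N)) :
  tens_class s = \sum_(p <- s) tens p.1 p.2.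
Proof.
elim: s => [|[x y] s IH]; first by rewrite big_nil.
by rewrite big_cons -IH [RHS]tens_addE.
Qed.

Lemma tens_sum (t : tensor) : t = \sum_(p <- repr t) tens p.1 p.2.
Proof. by rewrite -tens_piE /tens_class reprK. Qed.

Definition balanced (V : zmodType) (f : M -> N -> V) : Prop :=
  [/\ forall x x' y, f (x + x') y = f x y + f x' y,
      forall x y y', f x (y + y') = f x y + f x y'
    & forall x (a : A) y, f (x :* a) y = f x (a *: y)].

(* The additive map t |-> f x y on t = tens x y; meaningful for balanced f. *)
Definition tens_lift (V : zmodType) (f : M -> N -> V) (t : tensor) : V :=
  \sum_(p <- repr t) f p.1 p.2.

Section Lift.
Context (V : zmodType) (f : M -> N -> V) (bf : balanced f).

Lemma tens_lift_rel s t : tens_rel s t ->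
  \sum_(p <- s) f p.1 p.2 = \sum_(p <- t) f p.1 p.2.
Proof.
case: bf => fl fr fa; elim=> {s t} //.
- by move=> s t u _ -> _ ->.
- by move=> s s' t t' _ e _ e'; rewrite !big_cat /= e e'.
- by move=> s t; rewrite !big_cat /= addrC.
- move=> y; rewrite big_seq1 big_nil /=; apply: (addIr (f 0 y)).
  by rewrite -fl !add0r.
- by move=> x x' y; rewrite !big_cons !big_nil !addr0 /= fl.
- by move=> x y y'; rewrite !big_cons !big_nil !addr0 /= fr.
- by move=> x a y; rewrite !big_seq1 /= fa.
Qed.

Lemma tens_lift_pi (s : seq (M * N)) :
  tens_lift f (tens_class s) = \sum_(p <- s) f p.1 p.2.
Proof. exact/tens_lift_rel/tens_repr. Qed.

Lemma tens_liftE x y : tens_lift f (tens x y) = f x y.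
Proof. by rewrite tens_lift_pi big_seq1. Qed.

Lemma tens_liftD t u : tens_lift f (t + u) = tens_lift f t + tens_lift f u.
Proof.
elim/tens_classW: t => s; elim/tens_classW: u => s'.
by rewrite [tens_class s + tens_class s']tens_addE !tens_lift_pi big_cat.
Qed.

End Lift.

Lemma tens_ext (V : zmodType) (h k : tensor -> V) :
  (forall t u, h (t + u) = h t + h u) -> (forall t u, k (t + u) = k t + k u) ->
  (forall x y, h (tens x y) = k (tens x y)) -> forall t, h t = k t.
Proof.
move=> hD kD hk t; rewrite (tens_sum t).
have h0 : h 0 = 0 by apply: (addIr (h 0)); rewrite -hD !add0r.
have k0 : k 0 = 0 by apply: (addIr (k 0)); rewrite -kD !add0r.
by elim: (repr t) => [|p s IH]; rewrite ?big_nil ?h0 ?k0 // big_cons hD kD hk IH.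
Qed.

Lemma tens_scale_balanced (a : A) : balanced (fun x y => tens (a *: x) y).
Proof.
split=> [x x' y|x y y'|x b y]; first by rewrite scalerDr tensDl.
- exact: tensDr.
- by rewrite scale_rscale tensA.
Qed.

Lemma tens_rscale_balanced (a : A) : balanced (fun x y => tens x (y :* a)).
Proof.
split=> [x x' y|x y y'|x b y]; first exact: tensDl.
- by rewrite rscaleDl tensDr.
- by rewrite tensA scale_rscale.
Qed.

Definition tens_scale (a : A) : tensor -> tensor :=
  tens_lift (fun x y => tens (a *: x) y).
Definition tens_rscale (t : tensor) (a : A) : tensor :=
  tens_lift (fun x y => tens x (y :* a)) t.

Lemma tens_scaleE a x y : tens_scale a (tens x y) = tens (a *: x) y.
Proof. exact/tens_liftE/tens_scale_balanced. Qed.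
Lemma tens_scaleD a t u :
  tens_scale a (t + u) = tens_scale a t + tens_scale a u.
Proof. exact/tens_liftD/tens_scale_balanced. Qed.
Lemma tens_rscaleE x y a : tens_rscale (tens x y) a = tens x (y :* a).
Proof. exact: (tens_liftE (tens_rscale_balanced a)). Qed.
Lemma tens_rscaleD t u a :
  tens_rscale (t + u) a = tens_rscale t a + tens_rscale u a.
Proof. exact: (tens_liftD (tens_rscale_balanced a)). Qed.

Lemma tens_scaleA a b t : tens_scale a (tens_scale b t) = tens_scale (a * b) t.
Proof.
apply: (@tens_ext _ (fun t => tens_scale a (tens_scale b t))) t.
- by move=> t u; rewrite !tens_scaleD.
- exact: tens_scaleD.
- by move=> x y; rewrite !tens_scaleE scalerA.
Qed.

Lemma tens_scale1 : left_id 1 tens_scale.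
Proof.
move=> t; apply: (@tens_ext _ (tens_scale 1) id) t => //.
- exact: tens_scaleD.
- by move=> x y; rewrite tens_scaleE scale1r.
Qed.

Lemma tens_scaleDr : right_distributive tens_scale +%R.
Proof. exact: tens_scaleD. Qed.

Lemma tens_scaleDl t : {morph tens_scale^~ t : a b / a + b}.
Proof.
move=> a b.
apply: (@tens_ext _ (tens_scale (a + b))
  (fun t => tens_scale a t + tens_scale b t)) t.
- exact: tens_scaleD.
- by move=> t u; rewrite !tens_scaleD addrACA.
- by move=> x y; rewrite !tens_scaleE scalerDl tensDl.
Qed.

HB.instance Definition _ := GRing.Zmodule_isLmodule.Build A tensor
  tens_scaleA tens_scale1 tens_scaleDr tens_scaleDl.

Lemma tens_rscaleA t a b :
  tens_rscale (tens_rscale t a) b = tens_rscale t (a * b).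
Proof.
apply: (@tens_ext _ (fun t => tens_rscale (tens_rscale t a) b)
  (fun t => tens_rscale t (a * b))) t.
- by move=> t u; rewrite !tens_rscaleD.
- by move=> t u; rewrite tens_rscaleD.
- by move=> x y; rewrite !tens_rscaleE rscaleA.
Qed.

Lemma tens_rscale1 t : tens_rscale t 1 = t.
Proof.
apply: (@tens_ext _ (fun t => tens_rscale t 1) id) t => //.
- by move=> t u; rewrite tens_rscaleD.
- by move=> x y; rewrite tens_rscaleE rscale1.
Qed.

Lemma tens_rscaleDr t a b :
  tens_rscale t (a + b) = tens_rscale t a + tens_rscale t b.
Proof.
apply: (@tens_ext _ (fun t => tens_rscale t (a + b))
  (fun t => tens_rscale t a + tens_rscale t b)) t.
- by move=> t u; rewrite tens_rscaleD.
- by move=> t u; rewrite !tens_rscaleD addrACA.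
- by move=> x y; rewrite !tens_rscaleE rscaleDr tensDr.
Qed.

HB.instance Definition _ := isRightModule.Build A tensor
  tens_rscaleA tens_rscale1 tens_rscaleD tens_rscaleDr.

Lemma scale_tens (a : A) x y : a *: tens x y = tens (a *: x) y.
Proof. exact: tens_scaleE. Qed.

Lemma rscale_tens (a : A) x y : tens x y :* a = tens x (y :* a).
Proof. exact: tens_rscaleE. Qed.

Lemma tens_scale_rscale (a b : A) (t : tensor) :
  a *: (t :* b) = (a *: t) :* b.
Proof.
apply: (@tens_ext _ (fun t => a *: (t :* b)) (fun t => (a *: t) :* b)) t.
- by move=> t u; rewrite rscaleDl scalerDr.
- by move=> t u; rewrite scalerDr rscaleDl.
- by move=> x y; rewrite !(scale_tens, rscale_tens).
Qed.

Lemma tens_scalar (c : C) (t : tensor) : (c%:A : A) *: t = t :* (c%:A : A).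
Proof.
apply: (@tens_ext _ (fun t => (c%:A : A) *: t) (fun t => t :* (c%:A : A))) t.
- by move=> t u; rewrite scalerDr.
- by move=> t u; rewrite rscaleDl.
- by move=> x y; rewrite scale_tens rscale_tens scalar_bimod tensA scalar_bimod.
Qed.

HB.instance Definition _ := isBimodule.Build C A tensor
  tens_scale_rscale tens_scalar.

End Tensor.

Section DaggerTensor.
Context {C : numClosedFieldType} {A : starAlgType C} (M : dagBimodType A).

Definition tens_dag : tensor M M -> tensor M M :=
  tens_lift (fun x y => tens (dag y) (dag x)).

Lemma tens_dag_balanced :
  balanced (fun x y : M => tens (dag y) (dag x) : tensor M M).
Proof.
split=> [x x' y|x y y'|x a y]; first by rewrite dagD tensDr.
- by rewrite dagD tensDl.
- by rewrite dag_rscale dag_scale tensA.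
Qed.

Lemma tens_dagE (x y : M) : tens_dag (tens x y) = tens (dag y) (dag x).
Proof. exact/tens_liftE/tens_dag_balanced. Qed.

End DaggerTensor.

Section Modules.
Context {A : pzRingType}.

(* Finitely generated projective: a direct summand of a free module A^n. *)
Definition fg_projective (M : lmodType A) : Prop :=
  exists (n : nat) (p : {linear 'rV[A]_n -> M}) (i : {linear M -> 'rV[A]_n}),
    cancel i p.

Definition left_linear (M : lmodType A) : set (M -> A) :=
  [set f | (forall x y : M, f (x + y) = f x + f y) /\
           (forall (a : A) (x : M), f (a *: x) = a * f x)].

Definition right_linear (M : rmodType A) : set (M -> A) :=
  [set f | (forall x y : M, f (x + y) = f x + f y) /\
           (forall (x : M) (a : A), f (x :* a) = f x * a)].

Definition left_linearb (M : lmodType A) : {pred M -> A} :=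
  fun f => `[< @left_linear M f >].
Definition right_linearb (M : rmodType A) : {pred M -> A} :=
  fun f => `[< @right_linear M f >].

(* The left dual of a left module is a right module, and conversely. *)
Record ldual (M : lmodType A) := LDual {
  ldual_fun :> M -> A;
  ldual_subproof : ldual_fun \in @left_linearb M }.

Record rdual (M : rmodType A) := RDual {
  rdual_fun :> M -> A;
  rdual_subproof : rdual_fun \in @right_linearb M }.

Section LDual.
Context (M : lmodType A).

HB.instance Definition _ := [isSub for @ldual_fun M].
HB.instance Definition _ := [Choice of ldual M by <:].

Lemma left_linear_zmod_closed : zmod_closed (@left_linearb M).
Proof.
split; first by apply/asboolP; split=> * /=; rewrite ?mulr0 ?addr0.
move=> f g /asboolP[fD fZ] /asboolP[gD gZ]; apply/asboolP; split=> [x y|a x] /=.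
- by rewrite !fctE /= fD gD opprD addrACA.
- by rewrite !fctE /= fZ gZ mulrBr.
Qed.

HB.instance Definition _ :=
  GRing.isZmodClosed.Build (M -> A) (@left_linearb M) left_linear_zmod_closed.
HB.instance Definition _ := [SubChoice_isSubZmodule of ldual M by <:].

Lemma ldualP (f : ldual M) : left_linear f.
Proof. by case: f => f /= /asboolP. Qed.

Lemma ldual_ext (f g : ldual M) : f =1 g -> f = g.
Proof. by move=> fg; apply/val_inj/funext. Qed.

Definition to_ldual (f : M -> A) (fl : left_linear f) : ldual M :=
  LDual (introT (asboolP _) fl : f \in @left_linearb M).

Lemma ldual_rscale_subproof (f : ldual M) (b : A) :
  left_linear (fun x => f x * b).
Proof.
case: (ldualP f) => fD fZ.
by split=> [x y|a x]; rewrite ?fD ?mulrDl // fZ mulrA.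
Qed.

Definition ldual_rscale (f : ldual M) (b : A) : ldual M :=
  to_ldual (ldual_rscale_subproof f b).

Lemma ldual_rscaleA f a b :
  ldual_rscale (ldual_rscale f a) b = ldual_rscale f (a * b).
Proof. by apply: ldual_ext => x /=; rewrite mulrA. Qed.
Lemma ldual_rscale1 f : ldual_rscale f 1 = f.
Proof. by apply: ldual_ext => x /=; rewrite mulr1. Qed.
Lemma ldual_rscaleDl f g a :
  ldual_rscale (f + g) a = ldual_rscale f a + ldual_rscale g a.
Proof. by apply: ldual_ext => x /=; rewrite !fctE /= mulrDl. Qed.
Lemma ldual_rscaleDr f a b :
  ldual_rscale f (a + b) = ldual_rscale f a + ldual_rscale f b.
Proof. by apply: ldual_ext => x /=; rewrite !fctE /= mulrDr. Qed.

HB.instance Definition _ := isRightModule.Build A (ldual M)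
  ldual_rscaleA ldual_rscale1 ldual_rscaleDl ldual_rscaleDr.

End LDual.

Section RDual.
Context (M : rmodType A).

HB.instance Definition _ := [isSub for @rdual_fun M].
HB.instance Definition _ := [Choice of rdual M by <:].

Lemma right_linear_zmod_closed : zmod_closed (@right_linearb M).
Proof.
split; first by apply/asboolP; split=> * /=; rewrite ?mul0r ?addr0.
move=> f g /asboolP[fD fZ] /asboolP[gD gZ]; apply/asboolP; split=> [x y|x a] /=.
- by rewrite !fctE /= fD gD opprD addrACA.
- by rewrite !fctE /= fZ gZ mulrBl.
Qed.

HB.instance Definition _ :=
  GRing.isZmodClosed.Build (M -> A) (@right_linearb M) right_linear_zmod_closed.
HB.instance Definition _ := [SubChoice_isSubZmodule of rdual M by <:].

Lemma rdualP (f : rdual M) : right_linear f.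
Proof. by case: f => f /= /asboolP. Qed.

Lemma rdual_ext (f g : rdual M) : f =1 g -> f = g.
Proof. by move=> fg; apply/val_inj/funext. Qed.

Definition to_rdual (f : M -> A) (fl : right_linear f) : rdual M :=
  RDual (introT (asboolP _) fl : f \in @right_linearb M).

Lemma rdual_scale_subproof (a : A) (f : rdual M) :
  right_linear (fun x => a * f x).
Proof.
case: (rdualP f) => fD fZ.
by split=> [x y|x b]; rewrite ?fD ?mulrDr // fZ mulrA.
Qed.

Definition rdual_scale (a : A) (f : rdual M) : rdual M :=
  to_rdual (rdual_scale_subproof a f).

Lemma rdual_scaleA a b f :
  rdual_scale a (rdual_scale b f) = rdual_scale (a * b) f.
Proof. by apply: rdual_ext => x /=; rewrite mulrA. Qed.
Lemma rdual_scale1 : left_id 1 rdual_scale.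
Proof. by move=> f; apply: rdual_ext => x /=; rewrite mul1r. Qed.
Lemma rdual_scaleDr : right_distributive rdual_scale +%R.
Proof. by move=> a f g; apply: rdual_ext => x /=; rewrite !fctE /= mulrDr. Qed.
Lemma rdual_scaleDl f : {morph rdual_scale^~ f : a b / a + b}.
Proof. by move=> a b; apply: rdual_ext => x /=; rewrite !fctE /= mulrDl. Qed.

HB.instance Definition _ := GRing.Zmodule_isLmodule.Build A (rdual M)
  rdual_scaleA rdual_scale1 rdual_scaleDr rdual_scaleDl.

End RDual.
End Modules.

Section HermitianCalculus.
Context {C : numClosedFieldType} {A : starAlgType C}.

Record hermitian_first_order (Omega : dagBimodType A) := HermitianFirstOrder {
  dd : A -> Omega;
  ddD : forall a b : A, dd (a + b) = dd a + dd b;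
  ddZ : forall (c : C) (a : A), dd (c *: a) = (c%:A : A) *: dd a;
  ddM : forall a b : A, dd (a * b) = dd a :* b + a *: dd b;
  dd_star : forall a : A, dd (star a) = - dag (dd a);
  dd_gen : forall w : Omega,
    exists s : seq (A * A), w = \sum_(p <- s) p.1 *: dd p.2;
  fods_fgp : fg_projective Omega;
  ip : Omega -> Omega -> A;
  ipDl : forall w w' e : Omega, ip (w + w') e = ip w e + ip w' e;
  ipDr : forall w e e' : Omega, ip w (e + e') = ip w e + ip w e';
  ip_rscale : forall (w e : Omega) (a : A), ip w (e :* a) = ip w e * a;
  ip_star : forall w e : Omega, star (ip w e) = ip e w;
  ip_scale : forall (a : A) (w e : Omega), ip (a *: w) e = ip w (star a *: e);
  ip_sharp_linear : forall (a : A) (w w' e : Omega),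
    ip (dag (a *: w + w')) e = a * ip (dag w) e + ip (dag w') e;
  ip_sharp_bij : set_bij [set: Omega] (@right_linear A Omega)
    (fun w e => ip (dag w) e)
}.

Definition central (M : bimodType A) (y : M) : Prop :=
  forall a : A, a *: y = y :* a.

Definition centred (M : bimodType A) : Prop :=
  forall y : M, exists s : seq (A * {z : M | central z} * A),
    y = \sum_(p <- s) (p.1.1 *: sval p.1.2) :* p.2.

Definition bimod_map (M N : bimodType A) (f : M -> N) : Prop :=
  [/\ forall x y : M, f (x + y) = f x + f y,
      forall (a : A) (x : M), f (a *: x) = a *: f x
    & forall (x : M) (a : A), f (x :* a) = f x :* a].

(* On a centred bimodule exactly one map has these properties. *)
Definition is_sigma_can (Omega : dagBimodType A)
    (sigma : tensor Omega Omega -> tensor Omega Omega) : Prop :=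
  [/\ bimod_map sigma,
      exists tau : tensor Omega Omega -> tensor Omega Omega,
        [/\ cancel sigma tau, cancel tau sigma
          & forall t, tau (tens_dag t) = tens_dag (sigma t)]
    & forall w e : Omega, central w \/ central e ->
        sigma (tens w e) = tens e w].

Definition Psi (M : bimodType A) (sigma : M -> M) (t : M) : M :=
  ((2^-1)%:A : A) *: (t + sigma t).

Definition metric_g (Omega : dagBimodType A) (S : hermitian_first_order Omega) :
    tensor Omega Omega -> A :=
  tens_lift (fun w e => - ip S (dag w) e).

Lemma metric_gE (Omega : dagBimodType A) (S : hermitian_first_order Omega)
    (w e : Omega) : metric_g S (tens w e) = - ip S (dag w) e.
Proof.
apply: tens_liftE; split=> [x x' y|x y y'|x a y].
- by rewrite dagD ipDl opprD.
- by rewrite ipDr opprD.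
- by rewrite dag_rscale ip_scale starK.
Qed.

Definition JT2 (Omega : dagBimodType A) (S : hermitian_first_order Omega) :
    set (tensor Omega Omega) :=
  [set t | exists2 s : seq (A * A), \sum_(p <- s) p.1 *: dd S p.2 = 0
         & t = \sum_(p <- s) tens (dd S p.1) (dd S p.2)].

Record centred_hermitian_calculus (Omega : dagBimodType A) :=
  CentredHermitianCalculus {
  chc_fods :> hermitian_first_order Omega;
  sigma_can : tensor Omega Omega -> tensor Omega Omega;
  sigma_canP : is_sigma_can sigma_can;
  chc_centred : centred Omega;
  chc_g_sigma : forall t, metric_g chc_fods (sigma_can t) = metric_g chc_fods t;
  chc_JT2 : JT2 chc_fods `<=` range (Psi sigma_can)
}.

End HermitianCalculus.

Section MetricCalculus.
Context {C : numClosedFieldType} {A : starAlgType C}.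

Definition derivation : set (A -> A) :=
  [set d | [/\ forall a b : A, d (a + b) = d a + d b,
               forall (c : C) (a : A), d (c *: a) = c *: d a
             & forall a b : A, d (a * b) = d a * b + a * d b]].

Definition hermitian_der (d : A -> A) : Prop :=
  forall a : A, star (d (star a)) = d a.

Definition der_bracket (d1 d2 : A -> A) : A -> A :=
  fun a => d1 (d2 a) - d2 (d1 a).

Definition complex_lie_subalgebra (g : set (A -> A)) : Prop :=
  [/\ g `<=` derivation, g 0,
      forall (c : C) d1 d2, g d1 -> g d2 -> g (c *: d1 + d2)
    & forall d1 d2, g d1 -> g d2 -> g (der_bracket d1 d2)].

Definition real_lie_subalgebra (g : set (A -> A)) : Prop :=
  [/\ g `<=` derivation, g 0,
      forall (c : C) d1 d2, c \is Num.real -> g d1 -> g d2 -> g (c *: d1 + d2)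
    & forall d1 d2, g d1 -> g d2 -> g (der_bracket d1 d2)].

Record right_real_metric_calculus (X : rmodType A) (ipX : X -> X -> A)
    (gC g : set (A -> A)) (phi : gC -> X) : Prop := RightRealMetricCalculus {
  rrmc_ipD : forall x y z : X, ipX x (y + z) = ipX x y + ipX x z;
  rrmc_ip_rscale : forall (x y : X) (a : A), ipX x (y :* a) = ipX x y * a;
  rrmc_ip_star : forall x y : X, star (ipX x y) = ipX y x;
  rrmc_ip_nondeg : forall x : X, (forall y : X, ipX x y = 0) -> x = 0;
  rrmc_gC_lie : complex_lie_subalgebra gC;
  rrmc_g_hermitian : g = gC `&` hermitian_der;
  rrmc_g_lie : real_lie_subalgebra g;
  rrmc_phi_linear : forall (c : C) (d1 d2 d3 : gC),
    val d3 = c *: val d1 + val d2 -> phi d3 = phi d1 :* (c%:A : A) + phi d2;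
  rrmc_gen : forall x : X, exists s : seq ({d : gC | g (val d)} * A),
    x = \sum_(p <- s) phi (sval p.1) :* p.2;
  rrmc_real : forall d1 d2 : gC, g (val d1) -> g (val d2) ->
    star (ipX (phi d1) (phi d2)) = ipX (phi d1) (phi d2)
}.

Record left_real_metric_calculus (X : lmodType A) (ipX : X -> X -> A)
    (gC g : set (A -> A)) (phi : gC -> X) : Prop := LeftRealMetricCalculus {
  lrmc_ipD : forall x y z : X, ipX (x + y) z = ipX x z + ipX y z;
  lrmc_ip_scale : forall (a : A) (x y : X), ipX (a *: x) y = a * ipX x y;
  lrmc_ip_star : forall x y : X, star (ipX x y) = ipX y x;
  lrmc_ip_nondeg : forall x : X, (forall y : X, ipX x y = 0) -> x = 0;
  lrmc_gC_lie : complex_lie_subalgebra gC;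
  lrmc_g_hermitian : g = gC `&` hermitian_der;
  lrmc_g_lie : real_lie_subalgebra g;
  lrmc_phi_linear : forall (c : C) (d1 d2 d3 : gC),
    val d3 = c *: val d1 + val d2 -> phi d3 = (c%:A : A) *: phi d1 + phi d2;
  lrmc_gen : forall x : X, exists s : seq (A * {d : gC | g (val d)}),
    x = \sum_(p <- s) p.1 *: phi (sval p.2);
  lrmc_real : forall d1 d2 : gC, g (val d1) -> g (val d2) ->
    star (ipX (phi d1) (phi d2)) = ipX (phi d1) (phi d2)
}.

Definition right_strongly_nondegenerate (X : rmodType A) (ipX : X -> X -> A) :=
  set_bij [set: X] (@right_linear A X) (fun x => ipX x).

Definition left_strongly_nondegenerate (X : lmodType A) (ipX : X -> X -> A) :=
  set_bij [set: X] (@left_linear A X) (fun y x => ipX x y).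

End MetricCalculus.

Section VectorFields.
Context {C : numClosedFieldType} {A : starAlgType C} (Omega : dagBimodType A).

Local Notation right_vf := (rdual Omega).
Local Notation left_vf := (ldual Omega).

Record bi_vf := BiVF {
  bi_vf_fun :> Omega -> A;
  bi_vf_left : left_linear bi_vf_fun;
  bi_vf_right : right_linear bi_vf_fun }.

Definition left_of_bi_vf (X : bi_vf) : left_vf := to_ldual (bi_vf_left X).
Definition right_of_bi_vf (X : bi_vf) : right_vf := to_rdual (bi_vf_right X).

Context (S : hermitian_first_order Omega).

Definition left_ip (w r : Omega) : A := ip S (dag w) (dag r).

Lemma right_sharp_subproof (w : Omega) : right_linear (fun e => ip S (dag w) e).
Proof. by split=> *; rewrite ?ipDr ?ip_rscale. Qed.

Lemma left_sharp_subproof (w : Omega) : left_linear (fun e => ip S (dag e) w).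
Proof.
split=> [x y|a x]; first by rewrite dagD ipDl.
by rewrite dag_scale -[LHS]ip_star ip_rscale starM starK ip_star.
Qed.

Definition right_sharp (w : Omega) : right_vf :=
  to_rdual (right_sharp_subproof w).
Definition left_sharp (w : Omega) : left_vf :=
  to_ldual (left_sharp_subproof w).

Lemma right_sharp_surj (X : right_vf) : exists w, right_sharp w = X.
Proof.
have [_ _ surj] := ip_sharp_bij S.
have [w _ wX] := surj _ (rdualP X).
by exists w; apply: rdual_ext => e; rewrite /= -wX.
Qed.

Lemma left_sharp_surj (X : left_vf) : exists w, left_sharp w = X.
Proof.
have [_ _ surj] := ip_sharp_bij S.
have XL : right_linear (fun e : Omega => star (X (dag e))).
  case: (ldualP X) => XD XZ; split=> [x y|x a]; first by rewrite dagD XD starD.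
  by rewrite dag_rscale XZ starM starK.
have [w _ wX] := surj _ XL.
exists (dag w); apply: ldual_ext => e /=.
by rewrite -ip_star (congr1 (@^~ (dag e)) wX) /= starK dagK.
Qed.

Lemma right_sharp_inj : injective right_sharp.
Proof.
have [_ inj _] := ip_sharp_bij S.
move=> w w' /(congr1 (@rdual_fun _ _)) ww'.
by apply: inj; rewrite ?in_setT.
Qed.

Lemma left_sharp_inj : injective left_sharp.
Proof.
move=> w w' /(congr1 (@ldual_fun _ _)) ww'.
apply: (can_inj (@dagK _ _ Omega)); apply: right_sharp_inj.
apply: rdual_ext => e /=; rewrite !dagK -ip_star -[RHS]ip_star; congr star.
by have := congr1 (@^~ (dag e)) ww'; rewrite /= dagK.
Qed.

Definition right_flat (X : right_vf) : Omega := sval (cid (right_sharp_surj X)).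
Definition left_flat (X : left_vf) : Omega := sval (cid (left_sharp_surj X)).

Lemma right_flatK : cancel right_flat right_sharp.
Proof. by move=> X; rewrite /right_flat; case: cid. Qed.
Lemma left_flatK : cancel left_flat left_sharp.
Proof. by move=> X; rewrite /left_flat; case: cid. Qed.
Lemma right_sharpK : cancel right_sharp right_flat.
Proof. by move=> w; apply: right_sharp_inj; exact: right_flatK. Qed.
Lemma left_sharpK : cancel left_sharp left_flat.
Proof. by move=> w; apply: left_sharp_inj; exact: left_flatK. Qed.

Definition left_vf_ip (X Y : left_vf) : A := ip S (left_flat X) (left_flat Y).
Definition right_vf_ip (U V : right_vf) : A :=
  left_ip (right_flat U) (right_flat V).

Definition D_C : set (A -> A) :=
  [set d | derivation d /\
    forall s : seq (A * A), \sum_(p <- s) p.1 *: dd S p.2 = 0 ->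
      \sum_(p <- s) p.1 * d p.2 = 0].

Definition D_herm : set (A -> A) := D_C `&` hermitian_der.

Definition phi_fun (d : A -> A) (w : Omega) : A :=
  \sum_(p <- sval (cid (dd_gen S w))) p.1 * d p.2.

(* phi_fun d does not depend on the chosen representation of its argument. *)
Lemma phi_funE (d : A -> A) (s : seq (A * A)) : D_C d ->
  phi_fun d (\sum_(p <- s) p.1 *: dd S p.2) = \sum_(p <- s) p.1 * d p.2.
Proof.
move=> [_ dC]; rewrite /phi_fun; case: cid => t /= st.
apply/eqP; rewrite -subr_eq0; apply/eqP.
rewrite -[LHS](_ : \sum_(p <- t ++ [seq (- p.1, p.2) | p <- s]) p.1 * d p.2 = _).
  apply: dC; rewrite big_cat big_map /= -st.
  by under [X in _ + X]eq_bigr do rewrite scaleNr; rewrite sumrN subrr.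
rewrite big_cat big_map /=; congr (_ + _).
by under eq_bigr do rewrite mulNr; rewrite sumrN.
Qed.

Lemma phi_left (d : A -> A) : D_C d -> left_linear (phi_fun d).
Proof.
move=> dC; split=> [x y|a x].
- have [s ->] := dd_gen S x; have [t ->] := dd_gen S y.
  by rewrite -big_cat !phi_funE // big_cat.
- have [s ->] := dd_gen S x; rewrite phi_funE // scaler_sumr mulr_sumr.
  have -> : \sum_(p <- s) a *: (p.1 *: dd S p.2) =
      \sum_(p <- [seq (a * p.1, p.2) | p <- s]) p.1 *: dd S p.2.
    by rewrite big_map; apply: eq_bigr => p _; rewrite scalerA.
  by rewrite phi_funE // big_map; apply: eq_bigr => p _; rewrite mulrA.
Qed.

Lemma phi_right (d : A -> A) : D_C d -> right_linear (phi_fun d).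
Proof.
move=> dC; split=> [|x a]; first by case: (phi_left dC).
have [s ->] := dd_gen S x; rewrite phi_funE // rscale_suml mulr_suml.
have [[_ _ dM] _] := dC.
have -> : \sum_(p <- s) (p.1 *: dd S p.2) :* a =
    \sum_(p <- [seq (p.1, p.2 * a) | p <- s] ++
               [seq (- (p.1 * p.2), a) | p <- s]) p.1 *: dd S p.2.
  rewrite big_cat !big_map /= -big_split; apply: eq_bigr => p _ /=.
  by rewrite ddM scalerDr scalerA scaleNr addrK scale_rscale.
rewrite phi_funE // big_cat !big_map /= -big_split; apply: eq_bigr => p _ /=.
by rewrite dM mulrDr !mulrA mulNr addrK.
Qed.

Definition phi (d : D_C) : bi_vf :=
  BiVF (phi_left (set_mem (valP d))) (phi_right (set_mem (valP d))).

End VectorFields.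

(* Main.v *)
(* By the symmetry of g, both musical isomorphisms agree on central forms and
   exchange them with the bimodule maps X : Omega -> A; such an X is phi of the
   derivation X o d.  Since Omega is generated by its centre, the fields phi(D_C)
   generate, and the splitting of a derivation into Hermitian parts passes to D.
   As d anticommutes with the involutions, the form w dual to a Hermitian
   derivation satisfies dag w = - w, which with the symmetry of g gives reality.
   Closure of D_C under brackets is the only place where JT2 <= Im Psi enters: if
   sum a_i d b_i = 0, then sum d a_i (x) d b_i is fixed by sigma, so X (x) Y and
   Y (x) X agree on it, and this symmetric term cancels in the Leibniz rules for
   sum a_i [d1, d2] b_i. *)
Require Import Defs.
From HB Require Import structures.
From mathcomp Require Import all_boot all_order all_algebra.
From mathcomp Require Import boolp classical_sets functions reals complex.

Local Open Scope ring_scope.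

Import Order.TTheory GRing.Theory Num.Theory.

Set Implicit Arguments.
Unset Strict Implicit.
Unset Printing Implicit Defensive.

(** * Derivations of a star-algebra: adjoints, linear combinations, brackets *)

Section StarDerivations.
Context {C : numClosedFieldType} {A : starAlgType C}.

Lemma starN (a : A) : star (- a) = - star a.
Proof. by rewrite -scaleN1r starZ rmorphN1 scaleN1r. Qed.

Lemma star_sum (I : Type) (r : seq I) (F : I -> A) :
  star (\sum_(i <- r) F i) = \sum_(i <- r) star (F i).
Proof. by elim: r => [|i r IH]; rewrite ?big_nil ?star0 // !big_cons starD IH. Qed.

Lemma derivation_at0 (d : A -> A) : derivation d -> d 0 = 0.
Proof. by move=> [_ dZ _]; rewrite -(scale0r (0 : A)) dZ !scale0r. Qed.

Lemma derivation_sum (d : A -> A) (I : Type) (r : seq I) (F : I -> A) :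
  derivation d -> d (\sum_(i <- r) F i) = \sum_(i <- r) d (F i).
Proof.
move=> hd; have [dD _ _] := hd.
by elim: r => [|i r IH]; rewrite ?big_nil ?derivation_at0 // !big_cons dD IH.
Qed.

(** The conjugation on derivations whose fixed points are the Hermitian ones. *)
Definition adjoint_der (d : A -> A) : A -> A := fun a => star (d (star a)).

Lemma derivation_adjoint (d : A -> A) :
  derivation d -> derivation (adjoint_der d).
Proof.
move=> [dD dZ dM]; split=> [a b|c a|a b]; rewrite /adjoint_der.
- by rewrite starD dD starD.
- by rewrite starZ dZ starZ conjCK.
- by rewrite starM dM starD !starM !starK addrC.
Qed.

Lemma derivation_linear (c : C) (d1 d2 : A -> A) :
  derivation d1 -> derivation d2 -> derivation (c *: d1 + d2).
Proof.
move=> [d1D d1Z d1M] [d2D d2Z d2M]; split=> [a b|c' a|a b]; rewrite !fctE.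
- by rewrite d1D d2D scalerDr addrACA.
- by rewrite d1Z d2Z scalerDr !scalerA mulrC.
- rewrite d1M d2M scalerDr mulrDl mulrDr addrACA.
  by rewrite -scalerAl -scalerAr.
Qed.

Lemma derivation_bracket (d1 d2 : A -> A) :
  derivation d1 -> derivation d2 -> derivation (der_bracket d1 d2).
Proof.
move=> [d1D d1Z d1M] [d2D d2Z d2M].
split=> [a b|c' a|a b]; rewrite /der_bracket.
- by rewrite d1D d2D d1D d2D opprD addrACA.
- by rewrite d1Z d2Z d1Z d2Z scalerBr.
- rewrite d1M d2M d1D d2D !d1M !d2M mulrBl mulrBr.
  (* The mixed products of [d1] and [d2] occur in both compositions; they are collected here so as
     to cancel. *)
  rewrite [d1 a * d2 b + _]addrC [d2 a * d1 b + a * _]addrC.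
  rewrite [X in X - _]addrACA [X in _ - X]addrACA [d1 a * d2 b + d2 a * _]addrC.
  by rewrite opprD [LHS]addrACA subrr addr0 opprD addrACA.
Qed.

Lemma derivation0 : derivation (0 : A -> A).
Proof.
by split=> [a b|c a|a b] /=; rewrite ?addr0 ?scaler0 ?mul0r ?mulr0 ?addr0.
Qed.

End StarDerivations.

(** * Bimodules generated by central elements *)

Section CentralForms.
Context {C : numClosedFieldType} {A : starAlgType C} {Omega : dagBimodType A}.

Lemma dag0 : dag (0 : Omega) = 0.
Proof. by apply: (addIr (dag (0 : Omega))); rewrite -dagD !add0r. Qed.

Lemma dag_sum (I : Type) (r : seq I) (F : I -> Omega) :
  dag (\sum_(i <- r) F i) = \sum_(i <- r) dag (F i).
Proof. by elim: r => [|i r IH]; rewrite ?big_nil ?dag0 // !big_cons dagD IH. Qed.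

Lemma central_dag (z : Omega) : central z -> central (dag z).
Proof. by move=> cz a; rewrite -[a in LHS]starK -dag_rscale -cz dag_scale starK. Qed.

(** A right coefficient passes through a central element and merges with the left one: a z b = (a b)
    z. *)
Lemma centred_left (w : Omega) : centred Omega ->
  exists s : seq (A * {z : Omega | central z}), w = \sum_(p <- s) p.1 *: sval p.2.
Proof.
move=> /(_ w)[s ->]; exists [seq (p.1.1 * p.2, p.1.2) | p <- s].
rewrite big_map; apply: eq_bigr => -[[a [z cz]] b] _ /=.
by rewrite -scale_rscale -cz scalerA.
Qed.

Lemma centred_right (w : Omega) : centred Omega ->
  exists s : seq ({z : Omega | central z} * A), w = \sum_(p <- s) sval p.1 :* p.2.
Proof.
move=> /(centred_left w)[s ->]; exists [seq (p.2, p.1) | p <- s].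
by rewrite big_map; apply: eq_bigr => -[a [z cz]] _ /=.
Qed.

End CentralForms.

(** * Linearity of the musical isomorphisms; central forms and bimodule maps *)

Section FirstOrder.
Context {C : numClosedFieldType} {A : starAlgType C} {Omega : dagBimodType A}.
Variable S : hermitian_first_order Omega.

Lemma ipNl (w e : Omega) : ip S (- w) e = - ip S w e.
Proof.
have h0 : ip S 0 e = 0 by apply: (addIr (ip S 0 e)); rewrite -ipDl !add0r.
by apply: (addIr (ip S w e)); rewrite -ipDl !addNr h0.
Qed.

Lemma ipNr (w e : Omega) : ip S w (- e) = - ip S w e.
Proof. by rewrite -[LHS]ip_star ipNl starN ip_star. Qed.

Lemma ip_injr (w w' : Omega) : (forall e, ip S e w = ip S e w') -> w = w'.
Proof. by move=> h; apply: (@left_sharp_inj _ _ _ S); apply: ldual_ext => e /=; rewrite h. Qed.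

Lemma ip_injl (w w' : Omega) : (forall e, ip S w e = ip S w' e) -> w = w'.
Proof. by move=> h; apply: ip_injr => e; rewrite -[LHS]ip_star h ip_star. Qed.

Lemma left_sharpD (w e : Omega) : left_sharp S (w + e) = left_sharp S w + left_sharp S e.
Proof. by apply: ldual_ext => x /=; rewrite ipDr. Qed.

Lemma left_sharp_rscale (w : Omega) (a : A) : left_sharp S (w :* a) = left_sharp S w :* a.
Proof. by apply: ldual_ext => x /=; rewrite ip_rscale. Qed.

Lemma right_sharpD (w e : Omega) : right_sharp S (w + e) = right_sharp S w + right_sharp S e.
Proof. by apply: rdual_ext => x /=; rewrite dagD ipDl. Qed.

Lemma right_sharp_scale (a : A) (w : Omega) : right_sharp S (a *: w) = a *: right_sharp S w.
Proof.
apply: rdual_ext => x /=.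
by rewrite dag_scale -ip_star ip_rscale starM starK ip_star.
Qed.

Lemma left_flatD (X Y : ldual Omega) : left_flat S (X + Y) = left_flat S X + left_flat S Y.
Proof. by apply: (@left_sharp_inj _ _ _ S); rewrite left_sharpD !left_flatK. Qed.

Lemma left_flat_rscale (X : ldual Omega) (a : A) : left_flat S (X :* a) = left_flat S X :* a.
Proof. by apply: (@left_sharp_inj _ _ _ S); rewrite left_sharp_rscale !left_flatK. Qed.

Lemma right_flatD (X Y : rdual Omega) : right_flat S (X + Y) = right_flat S X + right_flat S Y.
Proof. by apply: (@right_sharp_inj _ _ _ S); rewrite right_sharpD !right_flatK. Qed.

Lemma right_flat_scale (a : A) (X : rdual Omega) : right_flat S (a *: X) = a *: right_flat S X.
Proof. by apply: (@right_sharp_inj _ _ _ S); rewrite right_sharp_scale !right_flatK. Qed.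

Lemma left_sharp_sum (I : Type) (r : seq I) (F : I -> Omega) :
  left_sharp S (\sum_(i <- r) F i) = \sum_(i <- r) left_sharp S (F i).
Proof.
elim: r => [|i r IH]; last by rewrite !big_cons left_sharpD IH.
by rewrite !big_nil; apply: (addIr (left_sharp S 0)); rewrite -left_sharpD !add0r.
Qed.

Lemma right_sharp_sum (I : Type) (r : seq I) (F : I -> Omega) :
  right_sharp S (\sum_(i <- r) F i) = \sum_(i <- r) right_sharp S (F i).
Proof.
elim: r => [|i r IH]; last by rewrite !big_cons right_sharpD IH.
by rewrite !big_nil; apply: (addIr (right_sharp S 0)); rewrite -right_sharpD !add0r.
Qed.

(** A right factor of the argument leaves the first slot as a left factor of [z]; centrality moves
    it to the right, where it comes out of the inner product. *)
Lemma left_sharp_right_linear (z : Omega) :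
  central z -> right_linear (left_sharp S z).
Proof.
move=> cz; split=> [x y|x a] /=; first by rewrite dagD ipDl.
by rewrite dag_rscale ip_scale starK cz ip_rscale.
Qed.

Definition central_bi_vf (z : Omega) (cz : central z) : bi_vf Omega :=
  BiVF (ldualP (left_sharp S z)) (left_sharp_right_linear cz).

(** Converse of the preceding construction: pairing [dag e] with [a] times the form gives X (e a),
    which right linearity turns into X e times [a]. *)
Lemma left_flat_central (X : bi_vf Omega) : central (left_flat S (left_of_bi_vf X)).
Proof.
move=> a; apply: (@left_sharp_inj _ _ _ S); apply: ldual_ext => e /=.
rewrite -{1}[a]starK -ip_scale -dag_rscale ip_rscale.
have E x : ip S (dag x) (left_flat S (left_of_bi_vf X)) = X x.
  by rewrite -[LHS]/(left_sharp S (left_flat S (left_of_bi_vf X)) x) left_flatK.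
by rewrite !E; case: (bi_vf_right X) => _ ->.
Qed.

(** * Strong non-degeneracy, transported from the forms *)

Lemma left_vf_ip_strongly_nondegenerate :
  right_strongly_nondegenerate (left_vf_ip S).
Proof.
split=> [x _|x y _ _ /= xy|f [fD fZ]].
- split=> [y z|y a]; rewrite /left_vf_ip; first by rewrite left_flatD ipDr.
  by rewrite left_flat_rscale ip_rscale.
- rewrite -[x](left_flatK S) -[y](left_flatK S); congr left_sharp.
  apply: ip_injl => e; have := congr1 (@^~ (left_sharp S e)) xy.
  by rewrite /left_vf_ip !left_sharpK.
- have [_ _ surj] := ip_sharp_bij S.
  have fR : right_linear (fun w => f (left_sharp S w)).
    by split=> [w e|w a]; rewrite ?left_sharpD ?fD // left_sharp_rscale fZ.
  have [w _ wf] := surj _ fR.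
  (* The functional is represented as [ip S (dag w)], so [dag w] is the form of the field sought. *)
  exists (left_sharp S (dag w)) => //; apply/funext=> y.
  by rewrite /left_vf_ip left_sharpK (congr1 (@^~ (left_flat S y)) wf) left_flatK.
Qed.

Lemma right_vf_ip_strongly_nondegenerate :
  left_strongly_nondegenerate (right_vf_ip S).
Proof.
split=> [y _|x y _ _ /= xy|f [fD fZ]].
- split=> [x z|a x]; rewrite /right_vf_ip /left_ip.
    by rewrite right_flatD dagD ipDl.
  rewrite right_flat_scale.
  (* Linearity in the first slot is [right_sharp_scale] evaluated at one form. *)
  exact: (congr1 (@^~ (dag (right_flat S y))) (congr1 (@rdual_fun _ _) (right_sharp_scale a _))).
- rewrite -[x](right_flatK S) -[y](right_flatK S); congr right_sharp.
  apply: (can_inj (@dagK _ _ Omega)).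
  apply: ip_injr => e; have := congr1 (@^~ (right_sharp S (dag e))) xy.
  by rewrite /right_vf_ip /left_ip !right_sharpK dagK.
- have fL : left_linear (fun w => f (right_sharp S w)).
    by split=> [w e|a w]; rewrite ?right_sharpD ?fD // right_sharp_scale fZ.
  have [w wf] := left_sharp_surj S (to_ldual fL).
  (* [left_ip] applies [dag] to its second form, which the dagger in the witness undoes. *)
  exists (right_sharp S (dag w)) => //; apply/funext=> y.
  rewrite /right_vf_ip /left_ip right_sharpK dagK.
  have /= -> := congr1 (fun g : ldual Omega => g (right_flat S y)) wf.
  by rewrite right_flatK.
Qed.

(** * Bimodule maps as derivations, and their Hermitian parts *)

Lemma phi_fun_dd (d : A -> A) (a : A) : D_C S d -> phi_fun S d (dd S a) = d a.
Proof.
move=> dC; have := phi_funE [:: (1, a)] dC.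
by rewrite !big_seq1 /= scale1r mul1r.
Qed.

Lemma bi_vf_dd_sum (X : bi_vf Omega) (s : seq (A * A)) :
  X (\sum_(p <- s) p.1 *: dd S p.2) = \sum_(p <- s) p.1 * X (dd S p.2).
Proof.
case: (bi_vf_left X) => XD XZ; elim: s => [|p s IH]; last by rewrite !big_cons XD XZ IH.
by rewrite !big_nil -(scale0r (0 : Omega)) XZ mul0r.
Qed.

(** Left linearity carries every relation among forms over to the values of [X], and linearity on
    both sides gives the Leibniz rule. *)
Lemma bi_vf_comp_dd (X : bi_vf Omega) : D_C S (fun a => X (dd S a)).
Proof.
case: (bi_vf_left X) (bi_vf_right X) => XD XZ [_ XR].
split=> [|s s0]; last first.
  by rewrite -bi_vf_dd_sum s0 -(scale0r (0 : Omega)) XZ mul0r.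
split=> [a b|c a|a b].
- by rewrite ddD XD.
- by rewrite ddZ XZ mulr_algl.
- by rewrite ddM XD XR XZ.
Qed.

Lemma phi_fun_comp_dd (X : bi_vf Omega) (w : Omega) :
  phi_fun S (fun a => X (dd S a)) w = X w.
Proof.
have [s ->] := dd_gen S w.
by rewrite (phi_funE _ (bi_vf_comp_dd X)) bi_vf_dd_sum.
Qed.

Lemma phi_fun_linear (c : C) (d1 d2 : A -> A) (w : Omega) :
  D_C S d1 -> D_C S d2 -> D_C S (c *: d1 + d2) ->
  phi_fun S (c *: d1 + d2) w = c *: phi_fun S d1 w + phi_fun S d2 w.
Proof.
move=> h1 h2 h3; have [s ->] := dd_gen S w; rewrite !phi_funE //.
rewrite scaler_sumr -big_split /=; apply: eq_bigr => p _.
by rewrite !fctE mulrDr scalerAr.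
Qed.

Lemma D_C_linear (c : C) (d1 d2 : A -> A) :
  D_C S d1 -> D_C S d2 -> D_C S (c *: d1 + d2).
Proof.
move=> [h1 k1] [h2 k2]; split=> [|s s0]; first exact: derivation_linear.
rewrite (eq_bigr (fun p => c *: (p.1 * d1 p.2) + p.1 * d2 p.2)); last first.
  by move=> p _; rewrite !fctE mulrDr scalerAr.
by rewrite big_split -scaler_sumr /= k1 // k2 // scaler0 addr0.
Qed.

Lemma D_C0 : D_C S 0.
Proof.
split=> [|s _]; first exact: derivation0.
by rewrite big1 // => p _; rewrite /= mulr0.
Qed.

(** Minus [dag] turns a relation between the a_i and [dd] b_i into one between [dd] of star b_i and
    right coefficients star a_i. The right-linear [phi_fun S d] respects it, and a final star
    returns the original order. *)
Lemma D_C_adjoint (d : A -> A) : D_C S d -> D_C S (adjoint_der d).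
Proof.
move=> dC; have [hd kd] := dC; split=> [|s s0]; first exact: derivation_adjoint.
have [pD pR] := phi_right dC.
have p0 : phi_fun S d 0 = 0 by rewrite -(rscale0r (0 : Omega)) pR mulr0.
have E : \sum_(p <- s) dd S (star p.2) :* star p.1 = 0.
  move/(congr1 (fun w => - dag w)): s0; rewrite dag0 oppr0 dag_sum -sumrN => s0.
  rewrite -[RHS]s0.
  by apply: eq_bigr => p _; rewrite dag_scale dd_star rscaleNl.
rewrite -[LHS]starK star_sum.
rewrite (eq_bigr (fun p => phi_fun S d (dd S (star p.2) :* star p.1))); last first.
  by move=> p _; rewrite starM starK pR phi_fun_dd.
transitivity (star (phi_fun S d 0)); last by rewrite p0 star0.
congr star; rewrite -E.
elim: s {s0 E} => [|p s IH]; first by rewrite !big_nil p0.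
by rewrite !big_cons IH pD.
Qed.

Lemma D_C_hermitian_parts (d : A -> A) : D_C S d ->
  exists d1 d2 : A -> A, [/\ D_herm S d1, D_herm S d2 & d = 'i *: d2 + d1].
Proof.
move=> dC; have aC := D_C_adjoint dC.
have linC (c : C) d1 : D_C S d1 -> D_C S (c *: d1).
  by move=> h; rewrite -[_ *: _]addr0; apply: D_C_linear => //; exact: D_C0.
(* Real and imaginary parts: with d' the adjoint of d, these are (d + d')/2 and (d - d')/(2i), where
   1/i = -i. *)
exists (2^-1 *: d + 2^-1 *: adjoint_der d).
exists ((- 'i / 2) *: d + ('i / 2) *: adjoint_der d).
split.
- split; first by apply: D_C_linear => //; exact: linC.
  move=> a; rewrite !fctE starD !starZ /adjoint_der !starK addrC.
  by rewrite fmorphV rmorph_nat.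
- split; first by apply: D_C_linear => //; exact: linC.
  move=> a; rewrite !fctE starD !starZ /adjoint_der !starK addrC.
  by rewrite !rmorphM rmorphN fmorphV rmorph_nat /= conjCi opprK.
- apply/funext=> a; rewrite !fctE scalerDr !scalerA !mulrA mulrN -expr2 sqrCi.
  rewrite opprK mul1r mulN1r scaleNr addrACA addNr addr0.
  by rewrite -scalerDl -div1r -splitr scale1r.
Qed.

(** Generators have to come from [D_herm], not merely from [D_C]; splitting the derivation attached
    to [X] supplies them. *)
Lemma bi_vf_hermitian_parts (X : bi_vf Omega) :
  exists d1 d2 : {d : D_C S | D_herm S (val d)},
    forall w, X w = phi (sval d1) w + 'i *: phi (sval d2) w.
Proof.
have [d1 [d2 [h1 h2 dE]]] := D_C_hermitian_parts (bi_vf_comp_dd X).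
have lift d : D_herm S d -> exists d' : {d : D_C S | D_herm S (val d)}, val (sval d') = d.
  by move=> hd; exists (exist _ (exist _ d (mem_set hd.1)) hd).
have [[e1 k1] /= E1] := lift _ h1; have [[e2 k2] /= E2] := lift _ h2.
exists (exist _ e1 k1), (exist _ e2 k2) => w /=.
rewrite E1 E2 -phi_fun_comp_dd dE [RHS]addrC phi_fun_linear //.
- exact: h2.1.
- exact: h1.1.
- by apply: D_C_linear; [exact: h2.1|exact: h1.1].
Qed.

(** The sign is that of [dd_star]: on a summand, [dag] of a [dd] b is minus [dd] (star b) times star
    a, and [phi_fun] is right linear. *)
Lemma phi_dag (d : A -> A) (w : Omega) : D_herm S d ->
  phi_fun S d (dag w) = - star (phi_fun S d w).
Proof.
move=> [dC hd]; have [pD pR] := phi_right dC.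
have p0 : phi_fun S d 0 = 0 by rewrite -(rscale0r (0 : Omega)) pR mulr0.
have [s ->] := dd_gen S w; rewrite phi_funE //.
elim: s => [|p s IH]; first by rewrite !big_nil dag0 p0 star0 oppr0.
rewrite !big_cons dagD pD IH starD opprD; congr (_ + _).
rewrite dag_scale -[dag _]opprK -dd_star rscaleNl.
have -> : phi_fun S d (- (dd S (star p.2) :* star p.1)) =
   - phi_fun S d (dd S (star p.2) :* star p.1).
  apply: (addIr (phi_fun S d (dd S (star p.2) :* star p.1))).
  by rewrite -pD !addNr p0.
by rewrite pR phi_fun_dd // starM -[d p.2]hd starK.
Qed.

End FirstOrder.

(** * Symmetry of the metric on central forms *)

Section CentredCalculus.
Context {C : numClosedFieldType} {A : starAlgType C} {Omega : dagBimodType A}.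
Variable S : centred_hermitian_calculus Omega.

(** Invariance of g under [sigma_can], read off at [tens z e], where [sigma_can] is the flip. *)
Lemma ip_central (z e : Omega) : central z -> ip S (dag z) e = ip S (dag e) z.
Proof.
move=> cz; have := chc_g_sigma S (tens z e).
have [_ _ ->] := sigma_canP S; last by left.
by rewrite !metric_gE => /oppr_inj.
Qed.

Lemma right_sharp_central (z e : Omega) : central z -> right_sharp S z e = left_sharp S z e.
Proof. exact: ip_central. Qed.

(** The form dual to a bimodule map is central, and there both sharps agree. *)
Lemma right_flat_bi_vf (X : bi_vf Omega) :
  right_flat S (right_of_bi_vf X) = left_flat S (left_of_bi_vf X).
Proof.
apply: (@right_sharp_inj _ _ _ S); rewrite right_flatK; apply: rdual_ext => e.
rewrite right_sharp_central; last exact: left_flat_central.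
by rewrite left_flatK.
Qed.

(** * Products of two fields on tensors, and closure under brackets *)

Definition bi_vf_tens (X Y : bi_vf Omega) : tensor Omega Omega -> A :=
  tens_lift (fun w e => X w * Y e).

Lemma bi_vf_tens_balanced (X Y : bi_vf Omega) : balanced (fun w e => X w * Y e).
Proof.
case: (bi_vf_left X) (bi_vf_right X) (bi_vf_left Y) => XD XZ [_ XR] [YD YZ].
by split=> [x x' y|x y y'|x a y] /=; rewrite ?XD ?YD ?mulrDl ?mulrDr // XR YZ mulrA.
Qed.

Lemma bi_vf_central (X : bi_vf Omega) (z : Omega) (a : A) :
  central z -> a * X z = X z * a.
Proof.
by move=> cz; case: (bi_vf_left X) (bi_vf_right X) => _ XZ [_ XR]; rewrite -XZ -XR cz.
Qed.

(* Omega is generated by its centre, which X and Y send to the centre of A, so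
   the two factors commute after the flip. *)
Lemma bi_vf_tens_sigma (X Y : bi_vf Omega) (t : tensor Omega Omega) :
  bi_vf_tens X Y (sigma_can S t) = bi_vf_tens Y X t.
Proof.
have [[sD _ _] _ sC] := sigma_canP S.
have lD U V := tens_liftD (bi_vf_tens_balanced U V).
have lE U V := tens_liftE (bi_vf_tens_balanced U V).
apply: (@tens_ext _ _ _ _ _ (fun t => bi_vf_tens X Y (sigma_can S t))
  (bi_vf_tens Y X)) t => [u v|u v|w e].
- by rewrite sD; exact: lD.
- exact: lD.
have [s ->] := centred_right w (chc_centred S).
elim: s => [|[[z cz] a] s IH].
  (* The zero tensor is written as 0 ⊗ 0 with 0 central, so that the flip rule also covers the empty
     sum. *)
  rewrite big_nil tens0l; have <- : tens 0 0 = 0 :> tensor Omega Omega by rewrite tens0l.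
  rewrite sC; last by left=> a; rewrite scaler0 rscale0l.
  by rewrite /bi_vf_tens !lE bi_vf_central // => a; rewrite scaler0 rscale0l.
rewrite big_cons tensDl sD /= {1}/bi_vf_tens [LHS]lD -/(bi_vf_tens _ _) IH.
rewrite [RHS]lD -/(bi_vf_tens _ _); congr (_ + _).
(* Once [a] has crossed the tensor sign, the central [z] stands alone in the first slot. *)
rewrite tensA sC; last by left.
by rewrite /bi_vf_tens !lE bi_vf_central.
Qed.

(** Such a tensor is half of u + sigma u, so X ⊗ Y takes on it half the sum of the values of X ⊗ Y
    and Y ⊗ X at u, which is symmetric in X and Y. *)
Lemma bi_vf_tens_JT2 (X Y : bi_vf Omega) (t : tensor Omega Omega) :
  JT2 S t -> bi_vf_tens X Y t = bi_vf_tens Y X t.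
Proof.
have lD U V := tens_liftD (bi_vf_tens_balanced U V).
move=> /(chc_JT2)[u _ <-]; rewrite /Psi.
have lZ U V (a : A) v : bi_vf_tens U V (a *: v) = a * bi_vf_tens U V v.
  apply: (@tens_ext _ _ _ _ _ (fun v => bi_vf_tens U V (a *: v))
    (fun v => a * bi_vf_tens U V v)) v => [x y|x y|x y].
  - by rewrite scalerDr; exact: lD.
  - by rewrite -mulrDr; congr (_ * _); exact: lD.
  - rewrite scale_tens /bi_vf_tens !(tens_liftE (bi_vf_tens_balanced U V)).
    by case: (bi_vf_left U) => _ ->; rewrite mulrA.
rewrite !lZ; congr (_ * _).
rewrite [LHS]lD [RHS]lD -!/(bi_vf_tens _ _) !bi_vf_tens_sigma.
exact: addrC.
Qed.

Lemma D_C_bracket (d1 d2 : A -> A) :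
  D_C S d1 -> D_C S d2 -> D_C S (der_bracket d1 d2).
Proof.
move=> h1 h2; split=> [|s s0]; first exact: (derivation_bracket h1.1 h2.1).
pose X1 := BiVF (phi_left h1) (phi_right h1).
pose X2 := BiVF (phi_left h2) (phi_right h2).
have tE U V : bi_vf_tens U V (\sum_(p <- s) tens (dd S p.1) (dd S p.2)) =
    \sum_(p <- s) U (dd S p.1) * V (dd S p.2).
  rewrite -(big_map (fun p => (dd S p.1, dd S p.2)) predT (fun q => tens q.1 q.2)).
  rewrite -tens_piE /bi_vf_tens tens_lift_pi; last exact: bi_vf_tens_balanced.
  by rewrite big_map.
have := @bi_vf_tens_JT2 X1 X2 _ (ex_intro2 _ _ s s0 (erefl _)).
rewrite !tE /=.
under eq_bigr do rewrite !phi_fun_dd //.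
under [RHS]eq_bigr do rewrite !phi_fun_dd //.
move=> sym.
(* Apply [d] to the relation that [d'] inherits from [s0]. *)
have leibniz d d' : D_C S d -> D_C S d' ->
    \sum_(p <- s) d p.1 * d' p.2 + \sum_(p <- s) p.1 * d (d' p.2) = 0.
  move=> [hd _] [_ ld']; rewrite -[RHS](derivation_at0 hd) -[in RHS](ld' _ s0).
  rewrite [RHS]derivation_sum // -big_split; apply: eq_bigr => p _.
  by case: hd => _ _ ->.
have e1 := leibniz _ _ h1 h2; have e2 := leibniz _ _ h2 h1; rewrite sym in e1.
(* After [sym] both Leibniz identities share their first sum; cancelling it equates the two
   second-order sums. *)
have /addrI : \sum_(p <- s) d2 p.1 * d1 p.2 + \sum_(p <- s) p.1 * d1 (d2 p.2) =
    \sum_(p <- s) d2 p.1 * d1 p.2 + \sum_(p <- s) p.1 * d2 (d1 p.2) by rewrite e1 e2.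
under eq_bigr do rewrite mulrBr.
by rewrite sumrB => ->; rewrite subrr.
Qed.

Lemma complex_lie_D_C : complex_lie_subalgebra (D_C S).
Proof.
split; first by move=> d [].
- exact: D_C0.
- exact: D_C_linear.
- exact: D_C_bracket.
Qed.

Lemma real_lie_D_herm : real_lie_subalgebra (D_herm S).
Proof.
split; first by move=> d [[]].
- by split; [exact: D_C0|move=> a; rewrite /= star0].
- move=> c d1 d2 cR [k1 h1] [k2 h2]; split; first exact: D_C_linear.
  by move=> a; rewrite !fctE starD starZ h1 h2 (CrealP cR).
- move=> d1 d2 [k1 h1] [k2 h2]; split; first exact: D_C_bracket.
  move=> a; rewrite /der_bracket starD starN.
  (* A double star between the two derivations lets the Hermitian condition act on each in turn. *)
  by rewrite -[d2 (star a)]starK -[d1 (star a)]starK !h1 !h2.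
Qed.

(** * Generation by Hermitian derivations, and reality of the inner products *)

Lemma left_vf_generated (x : ldual Omega) :
  exists s : seq ({d : D_C S | D_herm S (val d)} * A),
    x = \sum_(p <- s) left_of_bi_vf (phi (sval p.1)) :* p.2.
Proof.
rewrite -(left_flatK S x); have [r ->] := centred_right (left_flat S x) (chc_centred S).
rewrite left_sharp_sum; elim: r => [|[[z cz] a] r [s IH]].
  by exists [::]; rewrite !big_nil.
have [d1 [d2 zE]] := bi_vf_hermitian_parts S (central_bi_vf S cz).
(* Each central generator yields two Hermitian ones; the imaginary unit is absorbed into the
   coefficient. *)
exists [:: (d1, a), (d2, 'i%:A * a) & s]; rewrite !big_cons -IH addrA /=.
congr (_ + _); rewrite left_sharp_rscale -rscaleA -rscaleDl; congr (_ :* _).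
apply: ldual_ext => e; rewrite [LHS]zE /= !fctE /=.
by rewrite mulr_algr.
Qed.

Lemma right_vf_generated (x : rdual Omega) :
  exists s : seq (A * {d : D_C S | D_herm S (val d)}),
    x = \sum_(p <- s) p.1 *: right_of_bi_vf (phi (sval p.2)).
Proof.
rewrite -(right_flatK S x); have [r ->] := centred_left (right_flat S x) (chc_centred S).
rewrite right_sharp_sum; elim: r => [|[a [z cz]] r [s IH]].
  by exists [::]; rewrite !big_nil.
have [d1 [d2 zE]] := bi_vf_hermitian_parts S (central_bi_vf S cz).
exists [:: (a, d1), (a * 'i%:A, d2) & s]; rewrite !big_cons -IH addrA /=.
congr (_ + _); rewrite right_sharp_scale -scalerA -scalerDr; congr (_ *: _).
(* On a central form the right sharp is the left one, for which the splitting [zE] was obtained. *)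
apply: rdual_ext => e; rewrite right_sharp_central // [LHS]zE /= !fctE /=.
by rewrite mulr_algl.
Qed.

(** Let X be the field and w its form. Symmetry of g at the central [dag w] makes the pairing of e
    with [dag w] equal to star (X e), while e paired with w gives X (dag e); by [phi_dag] these
    differ by a sign. *)
Lemma dag_left_flat_phi (d : D_C S) : D_herm S (val d) ->
  dag (left_flat S (left_of_bi_vf (phi d))) = - left_flat S (left_of_bi_vf (phi d)).
Proof.
move=> hd; set w := left_flat S _.
have cw : central w by exact: left_flat_central.
have wE e : ip S (dag e) w = phi_fun S (val d) e.
  by rewrite -[LHS]/(left_sharp S w e) left_flatK.
apply: (ip_injr (S := S)) => e; rewrite ipNr -[e]dagK -ip_central; last exact: central_dag.
by rewrite [dag (dag w)]dagK -[LHS]ip_star !wE phi_dag // opprK.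
Qed.

(** The star exchanges the two forms; symmetry of g exchanges them back, at the price of two sign
    changes under [dag], which cancel. *)
Lemma left_vf_ip_real (d1 d2 : D_C S) : D_herm S (val d1) -> D_herm S (val d2) ->
  let ip12 := left_vf_ip S (left_of_bi_vf (phi d1)) (left_of_bi_vf (phi d2)) in
  star ip12 = ip12.
Proof.
move=> h1 h2; rewrite /= /left_vf_ip ip_star.
have c1 := left_flat_central S (phi d1).
rewrite -[X in ip S X _ = _]opprK -dag_left_flat_phi // ipNl -ip_central //.
by rewrite dag_left_flat_phi // ipNl opprK.
Qed.

(** [right_vf_ip] pairs the daggers of the same two forms and the signs cancel, so reality carries
    over to the right-linear fields. *)
Lemma right_vf_ip_phi (d1 d2 : D_C S) : D_herm S (val d1) -> D_herm S (val d2) ->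
  right_vf_ip S (right_of_bi_vf (phi d1)) (right_of_bi_vf (phi d2)) =
  left_vf_ip S (left_of_bi_vf (phi d1)) (left_of_bi_vf (phi d2)).
Proof.
move=> h1 h2; rewrite /right_vf_ip /left_ip !right_flat_bi_vf.
by rewrite !dag_left_flat_phi // ipNl ipNr opprK.
Qed.

End CentredCalculus.

(** * Assembly of the two metric calculi *)

Unset Implicit Arguments.

Theorem theorem3p24 (R : realType) (A : starAlgType R[i])
    (Omega : dagBimodType A) (S : centred_hermitian_calculus Omega) :
  (right_real_metric_calculus (left_vf_ip S) (D_herm S)
     (fun d : D_C S => left_of_bi_vf (phi d)) /\
   right_strongly_nondegenerate (left_vf_ip S)) /\
  (left_real_metric_calculus (right_vf_ip S) (D_herm S)
     (fun d : D_C S => right_of_bi_vf (phi d)) /\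
   left_strongly_nondegenerate (right_vf_ip S)).
Proof.
have phiE (c : R[i]) (d1 d2 d3 : D_C S) w : val d3 = c *: val d1 + val d2 ->
    phi d3 w = c *: phi d1 w + phi d2 w.
  have D (d : D_C S) : D_C S (val d) := set_mem (valP d).
  by move=> dE; rewrite /= dE phi_fun_linear //; apply: D_C_linear.
split; (split; last by [exact: left_vf_ip_strongly_nondegenerate
                       |exact: right_vf_ip_strongly_nondegenerate]).
- have [lin inj _] := left_vf_ip_strongly_nondegenerate S.
  have ipR x : right_linear (left_vf_ip S x) by exact: lin.
  split.
  + by move=> x y z; case: (ipR x).
  + by move=> x y a; case: (ipR x).
  + by move=> x y; exact: ip_star.
  (* Injectivity compares [x] with 0. Linearity is at hand in the second slot only, so the
     functional of 0 is seen to vanish through the star. *)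
  + move=> x x0; apply: inj; rewrite ?in_setT //; apply/funext => y.
    rewrite x0 -[RHS]ip_star -[X in star X]/(left_vf_ip S y 0).
    by rewrite -(rscale0r x) (ipR y).2 mulr0 star0.
  + exact: complex_lie_D_C.
  + by [].
  + exact: real_lie_D_herm.
  + move=> c d1 d2 d3 /phiE dE; apply: ldual_ext => w.
    by rewrite [LHS]dE /= !fctE /= mulr_algr.
  + exact: left_vf_generated.
  + by move=> d1 d2; exact: left_vf_ip_real.
- have [lin inj _] := right_vf_ip_strongly_nondegenerate S.
  have ipL y : left_linear ((right_vf_ip S)^~ y) by exact: lin.
  split.
  + by move=> x y z; case: (ipL z).
  + by move=> a x y; case: (ipL y).
  + by move=> x y; exact: ip_star.
  + move=> x x0; apply: inj; rewrite ?in_setT //; apply/funext => y.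
    (* Injectivity concerns the second slot and the hypothesis the first; the star exchanges
       them. *)
    rewrite -[LHS]ip_star [X in star X]x0 star0.
    rewrite -[RHS]ip_star -[X in star X]/(right_vf_ip S 0 y).
    by rewrite -(scale0r x) (ipL y).2 mul0r star0.
  + exact: complex_lie_D_C.
  + by [].
  + exact: real_lie_D_herm.
  + move=> c d1 d2 d3 /phiE dE; apply: rdual_ext => w.
    by rewrite [LHS]dE /= !fctE /= mulr_algl.
  + exact: right_vf_generated.
  + move=> d1 d2 h1 h2; rewrite right_vf_ip_phi //; exact: left_vf_ip_real.
Qed.
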